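(* Let $R$ and $R'$ be commutative unital rings and let $f:\mathcal{S}\to\mathcal{T}$ be a simplicially enriched functor between simplicially enriched categories. 1. For every $n\in\mathbb{N}$, the chain map $f_*$ induces an $R$-$R'$-bimodule homomorphism $\vec{H}_n(f):\vec{H}_n(R,\mathcal{S},R')\to\vec{H}_n(R,\mathcal{T},R')$. 2. If $f$ is injective on objects, then for every $a\in R[\mathcal{S}]$, $b\in R'[\mathcal{S}]$ and $u\in\vec{H}_n(R,\mathcal{S},R')$, $$\vec{H}_n(f)(a.u.b)=f_R(a).\,\vec{H}_n(f)(u)\,.f_S(b).$$
   Context: A simplicially enriched category $\mathcal{S}$ (with a set of objects) is a category enriched over simplicial sets: hom-objects $\mathcal{S}(A,B)$ are simplicial sets and composition $\mathcal{S}(A,B)\times\mathcal{S}(B,C)\to\mathcal{S}(A,C)$, $(f,g)\mapsto g\circ f$, is a simplicial map, with restriction $\circ_n$ to $n$-simplices. A $1$-morphism $X\to Y$ is a $0$-simplex of $\mathcal{S}(X,Y)$. A simplicially enriched functor is an enriched functor. The path algebra $R[\mathcal{S}]$ is the free left $R$-module on all $1$-morphisms, with $R$-bilinear product determined, for $f:X\to Y$, $g:Z\to T$, by $g\times f=g\circ_0 f$ if $Z=Y$ and $0$ otherwise. $C_n(R,\mathcal{S},R')$ is the free $R$-$R'$-bimodule (direct sum of copies of $R\otimes_{\mathbb{Z}}R'$) on $\bigcup_{A,B}(\mathcal{S}(A,B))_n$, with the $R[\mathcal{S}]$-$R'[\mathcal{S}]$-bimodule structure determined, for $1$-morphisms $f:X\to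 Y$, $g:U\to V$ and $\sigma\in(\mathcal{S}(A,B))_n$, by $f.\sigma.g=0$ if $V\ne A$ or $B\ne X$, and $f.\sigma.g=(s_{n-1}\cdots s_0)(f)\circ_n\sigma\circ_n(s_{n-1}\cdots s_0)(g)$ otherwise, $s_k$ being degeneracy operators. The boundary $d_n:C_n\to C_{n-1}$ ($n\ge1$; $d_0=0$) is the $R$-$R'$-linear map with $d_n(c)=\sum_{j=0}^n(-1)^j\partial_j c$ on simplices ($\partial_j$ the face operators); it is a bimodule homomorphism, and $\vec{H}_n(R,\mathcal{S},R')=\ker d_n/\operatorname{im}d_{n+1}$ is the resulting homology bimodule. $f_*:C_n(R,\mathcal{S},R')\to C_n(R,\mathcal{T},R')$ is the $R$-$R'$-linear map sending each simplex to its image under $f$. When $f$ is injective on objects, $f_R:R[\mathcal{S}]\to R[\mathcal{T}]$ and $f_S:R'[\mathcal{S}]\to R'[\mathcal{T}]$ are the algebra morphisms sending each $1$-morphism $t$ to $f(t)$. *)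

(* Defs.v *)
From HB Require Import structures.
From mathcomp Require Import all_boot all_order all_algebra.
From mathcomp Require Import finmap boolp.
From mathcomp.multinomials Require Import monalg.

Set Implicit Arguments.
Unset Strict Implicit.
Unset Printing Implicit Defensive.

Import GRing.Theory.
Local Open Scope fset_scope.
Local Open Scope ring_scope.
Local Open Scope quotient_scope.

HB.mixin Record Lmodule_isBimodule (R R' : pzRingType) (V : Type)
    of GRing.Lmodule R V := {
  ract : V -> R' -> V;
  ractDl : forall (u v : V) (b : R'), ract (u + v) b = ract u b + ract v b;
  ractDr : forall (u : V) (b c : R'), ract u (b + c) = ract u b + ract u c;
  ractr1 : forall u : V, ract u 1 = u;
  ractA : forall (u : V) (b c : R'), ract (ract u b) c = ract u (b * c);
  scaler_ract : forall (a : R) (u : V) (b : R'),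
    a *: ract u b = ract (a *: u) b }.

#[short(type="bimodType")]
HB.structure Definition Bimodule (R R' : pzRingType) :=
  {V of Lmodule_isBimodule R R' V & GRing.Lmodule R V}.

Notation "u *> b" := (ract u b) (at level 40, left associativity) : ring_scope.

Definition bimod_hom (R R' : pzRingType) (U V : bimodType R R') (h : U -> V) :=
  [/\ forall u v, h (u + v) = h u + h v,
      forall (a : R) u, h (a *: u) = a *: h u &
      forall u (b : R'), h (u *> b) = h u *> b].

Section Additive.
Variables (U V : zmodType) (h : U -> V).
Hypothesis hB : GRing.zmod_morphism h.

Lemma zmor0 : h 0 = 0. Proof. by rewrite -[X in h X](subrr 0) hB subrr. Qed.
Lemma zmorN u : h (- u) = - h u.
Proof. by rewrite -[- u]sub0r hB zmor0 sub0r. Qed.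
Lemma zmorD u v : h (u + v) = h u + h v.
Proof. by rewrite -{1}[v]opprK hB zmorN opprK. Qed.
Lemma zmor_sum I (r : seq I) P (E : I -> U) :
  h (\sum_(i <- r | P i) E i) = \sum_(i <- r | P i) h (E i).
Proof. exact: (big_morph h zmorD zmor0). Qed.
Lemma zmorMz u (z : int) : h (u *~ z) = h u *~ z.
Proof.
have hM n : h (u *+ n) = h u *+ n.
  by elim: n => [|n IHn]; rewrite ?mulr0n ?zmor0 // !mulrS zmorD IHn.
by case: z => n /=; rewrite ?NegzE ?mulrNz -?pmulrn ?zmorN hM.
Qed.
End Additive.

Lemma zmorP (U V : zmodType) (h : U -> V) :
  (forall u v, h (u + v) = h u + h v) -> GRing.zmod_morphism h.
Proof.
move=> hD; have h0 : h 0 = 0 by apply: (addrI (h 0)); rewrite -hD !addr0.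
move=> u v; rewrite hD; congr (_ + _).
by apply: (addrI (h v)); rewrite -hD !subrr.
Qed.

Lemma zmor_comp (U V W : zmodType) (g : V -> W) (h : U -> V) :
  GRing.zmod_morphism g -> GRing.zmod_morphism h ->
  GRing.zmod_morphism (fun u => g (h u)).
Proof. by move=> gB hB u v; rewrite hB gB. Qed.

Section QuotMap.
Variables (U V : zmodType) (I : zmodClosed U) (J : zmodClosed V).

(* Induced by h when h is additive and maps I into J: see quot_mapE. *)
Definition quot_map (h : U -> V) (x : Quotient.quot I) : Quotient.quot J :=
  \pi_(Quotient.quot J) (h (repr x)).

Lemma quot_mapE (h : U -> V) :
    GRing.zmod_morphism h -> (forall u, u \in I -> h u \in J) ->
  forall u, quot_map h (\pi_(Quotient.quot I) u) = \pi_(Quotient.quot J) (h u).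
Proof.
move=> hB hIJ u; rewrite /quot_map; apply/eqP; rewrite -Quotient.idealrBE -hB.
by apply: hIJ; rewrite Quotient.idealrBE reprK.
Qed.

Lemma quot_map_zmor (h : U -> V) :
    GRing.zmod_morphism h -> (forall u, u \in I -> h u \in J) ->
  GRing.zmod_morphism (quot_map h).
Proof.
move=> hB hIJ; elim/quotW=> x; elim/quotW=> y.
by rewrite -raddfB !quot_mapE // hB raddfB.
Qed.
End QuotMap.

Arguments quot_map {U V} I J h x.

Section MalgExt.
Variables (K : choiceType) (U W : zmodType).

Definition mext (F : K -> U -> W) (x : {malg U[K]}) : W :=
  \sum_(k <- msupp x) F k x@_k.

Variable F : K -> U -> W.
Hypothesis FB : forall k, GRing.zmod_morphism (F k).

Lemma mextEw (d : {fset K}%fset) (x : {malg U[K]}) :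
  (msupp x `<=` d)%fset -> mext F x = \sum_(k <- d) F k x@_k.
Proof.
move=> sub; rewrite /mext; apply: big_fset_incl => // k _ /mcoeff_outdom ->.
exact: zmor0.
Qed.

Lemma mext_zmor : GRing.zmod_morphism (mext F).
Proof.
move=> x y; pose d := (msupp x `|` msupp y)%fset.
rewrite (@mextEw d x) ?fsubsetUl // (@mextEw d y) ?fsubsetUr //.
rewrite (@mextEw d (x - y)) ?msuppB_le // -sumrB.
by apply: eq_bigr => k _; rewrite mcoeffB FB.
Qed.

Lemma mextU k u : mext F << u *g k >> = F k u.
Proof. by rewrite (mextEw msuppU_le) big_seq_fset1 mcoeffUU. Qed.
End MalgExt.

Lemma malg_ext (K : choiceType) (U W : zmodType) (g h : {malg U[K]} -> W) :
    GRing.zmod_morphism g -> GRing.zmod_morphism h ->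
    (forall k u, g << u *g k >> = h << u *g k >>) -> g =1 h.
Proof.
move=> gB hB gh x; rewrite [x]monalgE !zmor_sum //.
by apply: eq_bigr => k _; apply: gh.
Qed.

Section Push.
Variables (U : zmodType) (K L : choiceType).

Definition push (h : K -> L) : {malg U[K]} -> {malg U[L]} :=
  mext (fun k u => << u *g h k >>).

Lemma push_zmor h : GRing.zmod_morphism (push h).
Proof. by apply: mext_zmor => k; apply: monalgUB. Qed.

Lemma pushU h k u : push h << u *g k >> = << u *g h k >>.
Proof. by apply: mextU => {}k; apply: monalgUB. Qed.
End Push.

(* The bilinear map of free modules determined by a biadditive pairing phi of
   coefficients and a partial product m of basis elements, undefined products
   being sent to 0. *)
Section Bilinear.
Variables (U V W : zmodType) (K L M : choiceType).

Definition mbil (phi : U -> V -> W) (m : K -> L -> option M)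
    (x : {malg U[K]}) (y : {malg V[L]}) : {malg W[M]} :=
  \sum_(k <- msupp x) \sum_(l <- msupp y)
    if m k l is Some p then << phi x@_k y@_l *g p >> else 0.

Variables (phi : U -> V -> W) (m : K -> L -> option M).
Hypothesis phiBl : forall v, GRing.zmod_morphism (phi^~ v).
Hypothesis phiBr : forall u, GRing.zmod_morphism (phi u).

Let term k u l v : {malg W[M]} :=
  if m k l is Some p then << phi u v *g p >> else 0.

Lemma mbil_zmor_r x : GRing.zmod_morphism (mbil phi m x).
Proof.
have E y : mbil phi m x y =
    \sum_(k <- msupp x) mext (fun l v => term k x@_k l v) y by [].
move=> y z; rewrite !E -sumrB; apply: eq_bigr => k _; apply: mext_zmor => l.
by move=> v w; rewrite /term; case: (m k l) => [p|]; rewrite ?subr0 ?phiBr ?monalgUB.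
Qed.

Lemma mbil_zmor_l y : GRing.zmod_morphism ((mbil phi m)^~ y).
Proof.
have E x : mbil phi m x y =
    mext (fun k u => \sum_(l <- msupp y) term k u l y@_l) x by [].
move=> x z; rewrite !E; apply: mext_zmor => k u v.
rewrite -sumrB; apply: eq_bigr => l _; rewrite /term.
case: (m k l) => [p|]; rewrite ?subr0 // -monalgUB; congr << _ *g _ >>.
exact: phiBl.
Qed.

Lemma mbilU k u l v : mbil phi m << u *g k >> << v *g l >> =
  if m k l is Some p then << phi u v *g p >> else 0.
Proof.
have E x : mbil phi m x << v *g l >> = mext (fun k u =>
    mext (fun l v => term k u l v) << v *g l >>) x by [].
have tBr k' u' l' : GRing.zmod_morphism (term k' u' l').
  by move=> a b; rewrite /term; case: (m k' l') => [p|];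
     rewrite ?subr0 ?phiBr ?monalgUB.
rewrite E mextU ?mextU // => k' a b.
rewrite !mextU // /term; case: (m k' l) => [p|]; rewrite ?subr0 // -monalgUB.
congr << _ *g _ >>; exact: phiBl.
Qed.
End Bilinear.

Lemma mbil_assoc (U1 U2 U3 U12 U23 W : zmodType)
    (K1 K2 K3 K12 K23 M : choiceType)
    (p12 : U1 -> U2 -> U12) (p12_3 : U12 -> U3 -> W)
    (p23 : U2 -> U3 -> U23) (p1_23 : U1 -> U23 -> W)
    (m12 : K1 -> K2 -> option K12) (m12_3 : K12 -> K3 -> option M)
    (m23 : K2 -> K3 -> option K23) (m1_23 : K1 -> K23 -> option M) :
    (forall v, GRing.zmod_morphism (p12^~ v)) ->
    (forall u, GRing.zmod_morphism (p12 u)) ->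
    (forall v, GRing.zmod_morphism (p12_3^~ v)) ->
    (forall u, GRing.zmod_morphism (p12_3 u)) ->
    (forall v, GRing.zmod_morphism (p23^~ v)) ->
    (forall u, GRing.zmod_morphism (p23 u)) ->
    (forall v, GRing.zmod_morphism (p1_23^~ v)) ->
    (forall u, GRing.zmod_morphism (p1_23 u)) ->
    (forall u v w, p12_3 (p12 u v) w = p1_23 u (p23 v w)) ->
    (forall k l j, obind (fun i => m12_3 i j) (m12 k l) =
                   obind (m1_23 k) (m23 l j)) ->
  forall x y z, mbil p12_3 m12_3 (mbil p12 m12 x y) z =
                mbil p1_23 m1_23 x (mbil p23 m23 y z).
Proof.
move=> b1 b1' b2 b2' b3 b3' b4 b4' pA mA x y z.
move: x; apply: malg_ext => [||k u].
- exact: (zmor_comp (mbil_zmor_l m12_3 b2 z) (mbil_zmor_l m12 b1 y)).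
- exact: (mbil_zmor_l m1_23 b4).
move: y; apply: malg_ext => [||l v].
- exact: (zmor_comp (mbil_zmor_l m12_3 b2 z) (mbil_zmor_r m12 b1' _)).
- exact: (zmor_comp (mbil_zmor_r m1_23 b4' _) (mbil_zmor_l m23 b3 z)).
move: z; apply: malg_ext => [||j w].
- exact: (mbil_zmor_r m12_3 b2').
- exact: (zmor_comp (mbil_zmor_r m1_23 b4' _) (mbil_zmor_r m23 b3' _)).
rewrite !mbilU //; have := mA k l j.
case: (m12 k l) => [i|] /=; case: (m23 l j) => [i'|] /= e;
  rewrite ?(zmor0 (mbil_zmor_l m12_3 b2 _)) ?(zmor0 (mbil_zmor_r m1_23 b4' _));
  rewrite ?mbilU // ?e -?e //.
by rewrite pA.
Qed.

Lemma push_mbil (U V W : zmodType) (K L M K' L' M' : choiceType)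
    (phi : U -> V -> W) (m : K -> L -> option M) (m' : K' -> L' -> option M')
    (hk : K -> K') (hl : L -> L') (hm : M -> M') :
    (forall v, GRing.zmod_morphism (phi^~ v)) ->
    (forall u, GRing.zmod_morphism (phi u)) ->
    (forall k l, m' (hk k) (hl l) = omap hm (m k l)) ->
  forall x y, push hm (mbil phi m x y) = mbil phi m' (push hk x) (push hl y).
Proof.
move=> bl br hmm x y; move: x; apply: malg_ext => [||k u].
- exact: (zmor_comp (push_zmor hm) (mbil_zmor_l m bl y)).
- exact: (zmor_comp (mbil_zmor_l m' bl _) (push_zmor hk)).
move: y; apply: malg_ext => [||l v].
- exact: (zmor_comp (push_zmor hm) (mbil_zmor_r m br _)).
- exact: (zmor_comp (mbil_zmor_r m' br _) (push_zmor hl)).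
rewrite !pushU !mbilU // hmm; case: (m k l) => [p|] /=; rewrite ?pushU //.
exact: (zmor0 (push_zmor hm)).
Qed.

Definition freemod (V : zmodType) (K : choiceType) : Type := {malg V[K]}.

HB.instance Definition _ (V : zmodType) (K : choiceType) :=
  GRing.Zmodule.copy (freemod V K) {malg V[K]}.

Section FreeLmod.
Variables (R : pzRingType) (V : lmodType R) (K : choiceType).
Implicit Types x y : freemod V K.

Definition fscale (a : R) : freemod V K -> freemod V K :=
  mext (fun k v => << a *: v *g k >>).

Let scaleB (a : R) k :
  GRing.zmod_morphism (fun v : V => << a *: v *g k >> : {malg V[K]}).
Proof. by move=> u v; rewrite scalerBr monalgUB. Qed.

Lemma fscale_zmor a : GRing.zmod_morphism (fscale a).
Proof. exact/mext_zmor/scaleB. Qed.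

Lemma fscaleU a k v : fscale a << v *g k >> = << a *: v *g k >>.
Proof. exact/mextU/scaleB. Qed.

Let fscaleA a b x : fscale a (fscale b x) = fscale (a * b) x.
Proof.
move: x; apply: malg_ext => [||k v]; last by rewrite !fscaleU scalerA.
- exact: zmor_comp (fscale_zmor _) (fscale_zmor _).
- exact: fscale_zmor.
Qed.

Let fscale1 x : fscale 1 x = x.
Proof.
move: x; apply: malg_ext => [||k v]; last by rewrite fscaleU scale1r.
- exact: fscale_zmor.
- by [].
Qed.

Let fscaleDr a x y : fscale a (x + y) = fscale a x + fscale a y.
Proof. exact/zmorD/fscale_zmor. Qed.

Let fscaleDl x a b : fscale (a + b) x = fscale a x + fscale b x.
Proof.
move: x; apply: malg_ext => [|x y|k v].
- exact: fscale_zmor.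
- by rewrite !fscale_zmor opprD addrACA.
- by rewrite !fscaleU scalerDl monalgUD.
Qed.

HB.instance Definition _ := GRing.Zmodule_isLmodule.Build R (freemod V K)
  fscaleA fscale1 fscaleDr fscaleDl.

Lemma scaleU (a : R) k v :
  a *: (<< v *g k >> : freemod V K) = << a *: v *g k >>.
Proof. exact: fscaleU. Qed.
End FreeLmod.

Section FreeBimod.
Variables (R R' : pzRingType) (V : bimodType R R') (K : choiceType).
Implicit Types x y : freemod V K.

Lemma ract_zmor (W : bimodType R R') (b : R') :
  GRing.zmod_morphism (fun v : W => v *> b).
Proof. by apply: zmorP => u v; apply: ractDl. Qed.

Lemma ract_zmor_r (W : bimodType R R') (v : W) :
  GRing.zmod_morphism (fun b : R' => v *> b).
Proof. by apply: zmorP => a b; apply: ractDr. Qed.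

Definition fract x (b : R') : freemod V K :=
  mext (fun k v => << v *> b *g k >>) x.

Let ractB (b : R') k :
  GRing.zmod_morphism (fun v : V => << v *> b *g k >> : {malg V[K]}).
Proof. by move=> u v; rewrite ract_zmor monalgUB. Qed.

Lemma fract_zmor b : GRing.zmod_morphism (fract^~ b).
Proof. exact/mext_zmor/ractB. Qed.

Lemma fractU b k v : fract << v *g k >> b = << v *> b *g k >>.
Proof. exact/mextU/ractB. Qed.

Let fractDl x y b : fract (x + y) b = fract x b + fract y b.
Proof. exact: (zmorD (fract_zmor b)). Qed.

Let fractDr x b c : fract x (b + c) = fract x b + fract x c.
Proof.
move: x; apply: malg_ext => [|x y|k v].
- exact: fract_zmor.
- by rewrite !fract_zmor opprD addrACA.
- by rewrite !fractU ractDr monalgUD.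
Qed.

Let fractr1 x : fract x 1 = x.
Proof.
move: x; apply: malg_ext => [||k v]; last by rewrite fractU ractr1.
- exact: fract_zmor.
- by [].
Qed.

Let fractA x b c : fract (fract x b) c = fract x (b * c).
Proof.
move: x; apply: malg_ext => [||k v]; last by rewrite !fractU ractA.
- exact: zmor_comp (fract_zmor _) (fract_zmor _).
- exact: fract_zmor.
Qed.

Let fscale_ract (a : R) x b : a *: fract x b = fract (a *: x) b.
Proof.
move: x; apply: malg_ext => [||k v].
- exact: zmor_comp (@scalerBr _ _ a) (fract_zmor _).
- exact: zmor_comp (fract_zmor _) (@scalerBr _ _ a).
- by rewrite fractU !scaleU fractU scaler_ract.
Qed.

HB.instance Definition _ := Lmodule_isBimodule.Build R R' (freemod V K)
  fractDl fractDr fractr1 fractA fscale_ract.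

Lemma ractU k v (b : R') :
  (<< v *g k >> : freemod V K) *> b = << v *> b *g k >>.
Proof. exact: fractU. Qed.
End FreeBimod.

(* The tensor product over Z, as the quotient of the free abelian group on
   R * R' by the biadditivity relations; Z-balancedness follows from them. *)
Section Tensor.
Variables R R' : pzRingType.

Inductive tens_rel : {malg int[(R * R')%type]} -> Prop :=
| tens_rel0 : tens_rel 0
| tens_relB x y : tens_rel x -> tens_rel y -> tens_rel (x - y)
| tens_rell a b s : tens_rel (<< (a + b, s) >> - << (a, s) >> - << (b, s) >>)
| tens_relr a s t : tens_rel (<< (a, s + t) >> - << (a, s) >> - << (a, t) >>).

Definition tens_rel_pred : {pred {malg int[(R * R')%type]}} :=
  fun x => `[< tens_rel x >].

Fact tens_rel_closed : GRing.zmod_closed tens_rel_pred.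
Proof.
split=> [|x y /asboolP hx /asboolP hy]; apply/asboolP; first exact: tens_rel0.
exact: tens_relB.
Qed.

HB.instance Definition _ :=
  GRing.isZmodClosed.Build _ tens_rel_pred tens_rel_closed.

Definition tens : Type := Quotient.quot tens_rel_pred.

HB.instance Definition _ :=
  GRing.Zmodule.copy tens (Quotient.quot tens_rel_pred).

Definition tensor (a : R) (s : R') : tens :=
  \pi_(Quotient.quot tens_rel_pred) << (a, s) >>.

Definition tscale (a : R) : tens -> tens :=
  quot_map tens_rel_pred tens_rel_pred (push (fun p => (a * p.1, p.2))).
Definition tract (t : tens) (s : R') : tens :=
  quot_map tens_rel_pred tens_rel_pred (push (fun p => (p.1, p.2 * s))) t.

Lemma tensorDl a b s : tensor (a + b) s = tensor a s + tensor b s.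
Proof.
apply/eqP; rewrite /tensor -raddfD -Quotient.idealrBE opprD addrA.
exact/asboolP/tens_rell.
Qed.

Lemma tensorDr a s t : tensor a (s + t) = tensor a s + tensor a t.
Proof.
apply/eqP; rewrite /tensor -raddfD -Quotient.idealrBE opprD addrA.
exact/asboolP/tens_relr.
Qed.

Let tens_push (h : R * R' -> R * R') :
    (forall a b s, tens_rel (<< h (a + b, s) >> - << h (a, s) >> - << h (b, s) >>)) ->
    (forall a s t, tens_rel (<< h (a, s + t) >> - << h (a, s) >> - << h (a, t) >>)) ->
  forall x, x \in tens_rel_pred -> push h x \in tens_rel_pred.
Proof.
move=> hl hr x /asboolP xr; apply/asboolP.
elim: xr => [|{}x y _ IHx _ IHy|a b s|a s t]; rewrite ?(zmor0 (push_zmor h)).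
- exact: tens_rel0.
- by rewrite push_zmor; apply: tens_relB.
- by rewrite !push_zmor !pushU.
- by rewrite !push_zmor !pushU.
Qed.

Let tscale_rel a x : x \in tens_rel_pred ->
  push (fun p : R * R' => (a * p.1, p.2)) x \in tens_rel_pred.
Proof.
apply: tens_push => [b c s|b s t] /=; first by rewrite mulrDr; apply: tens_rell.
exact: tens_relr.
Qed.

Let tract_rel s x : x \in tens_rel_pred ->
  push (fun p : R * R' => (p.1, p.2 * s)) x \in tens_rel_pred.
Proof.
apply: tens_push => [b c t|b t u] /=; last by rewrite mulrDl; apply: tens_relr.
exact: tens_rell.
Qed.

Lemma tscale_zmor a : GRing.zmod_morphism (tscale a).
Proof. exact: (quot_map_zmor (push_zmor _) (@tscale_rel a)). Qed.

Lemma tract_zmor s : GRing.zmod_morphism (tract^~ s).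
Proof. exact: (quot_map_zmor (push_zmor _) (@tract_rel s)). Qed.

Lemma tscale_tensor a b s : tscale a (tensor b s) = tensor (a * b) s.
Proof.
rewrite /tscale /tensor (quot_mapE (push_zmor _) (@tscale_rel a)).
by rewrite pushU.
Qed.

Lemma tract_tensor b s t : tract (tensor b s) t = tensor b (s * t).
Proof.
rewrite /tract /tensor (quot_mapE (push_zmor _) (@tract_rel t)).
by rewrite pushU.
Qed.

Lemma tens_ext (W : zmodType) (g h : tens -> W) :
    GRing.zmod_morphism g -> GRing.zmod_morphism h ->
    (forall a s, g (tensor a s) = h (tensor a s)) -> g =1 h.
Proof.
move=> gB hB gh; elim/quotW => x; move: x.
have piB : GRing.zmod_morphism \pi_(Quotient.quot tens_rel_pred) by exact: raddfB.
apply: malg_ext => [||[a s] z]; try exact: zmor_comp.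
have -> : << z *g (a, s) >> = << (a, s) >> *~ z :> {malg int[(R * R')%type]}.
  rewrite -(zmorMz (@monalgUB _ _ (a, s)) 1 z); congr << _ *g _ >>.
  by rewrite intz.
by rewrite (zmorMz (zmor_comp gB piB)) (zmorMz (zmor_comp hB piB)) gh.
Qed.

Let tscaleA a b t : tscale a (tscale b t) = tscale (a * b) t.
Proof.
move: t; apply: tens_ext => [||c s]; last by rewrite !tscale_tensor mulrA.
- exact: zmor_comp (tscale_zmor _) (tscale_zmor _).
- exact: tscale_zmor.
Qed.

Let tscale1 t : tscale 1 t = t.
Proof.
move: t; apply: tens_ext => [||c s]; last by rewrite tscale_tensor mul1r.
- exact: tscale_zmor.
- by [].
Qed.

Let tscaleDr a t u : tscale a (t + u) = tscale a t + tscale a u.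
Proof. exact/zmorD/tscale_zmor. Qed.

Let tscaleDl t a b : tscale (a + b) t = tscale a t + tscale b t.
Proof.
move: t; apply: tens_ext => [|t u|c s].
- exact: tscale_zmor.
- by rewrite !tscale_zmor opprD addrACA.
- by rewrite !tscale_tensor mulrDl tensorDl.
Qed.

HB.instance Definition _ := GRing.Zmodule_isLmodule.Build R tens
  tscaleA tscale1 tscaleDr tscaleDl.

Let tractDl t u s : tract (t + u) s = tract t s + tract u s.
Proof. exact: (zmorD (tract_zmor s)). Qed.

Let tractDr t s s' : tract t (s + s') = tract t s + tract t s'.
Proof.
move: t; apply: tens_ext => [|t u|c r].
- exact: tract_zmor.
- by rewrite !tract_zmor opprD addrACA.
- by rewrite !tract_tensor mulrDr tensorDr.
Qed.

Let tractr1 t : tract t 1 = t.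
Proof.
move: t; apply: tens_ext => [||c s]; last by rewrite tract_tensor mulr1.
- exact: tract_zmor.
- by [].
Qed.

Let tractA t s s' : tract (tract t s) s' = tract t (s * s').
Proof.
move: t; apply: tens_ext => [||c r]; last by rewrite !tract_tensor mulrA.
- exact: zmor_comp (tract_zmor _) (tract_zmor _).
- exact: tract_zmor.
Qed.

Let tscale_ract (a : R) t s : a *: tract t s = tract (a *: t) s.
Proof.
move: t; apply: tens_ext => [||c r].
- exact: zmor_comp (@scalerBr _ _ a) (tract_zmor _).
- exact: zmor_comp (tract_zmor _) (@scalerBr _ _ a).
- by rewrite tract_tensor /GRing.scale /= !tscale_tensor tract_tensor.
Qed.

HB.instance Definition _ := Lmodule_isBimodule.Build R R' tens
  tractDl tractDr tractr1 tractA tscale_ract.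
End Tensor.

(* The simplicial identities are indexed so that every operator has an index
   of the right type: lift ord0 j is j + 1, and widen_ord is the inclusion. *)
Record sset := SSet {
  spx :> nat -> Type;
  face : forall n, 'I_n.+2 -> spx n.+1 -> spx n;
  degen : forall n, 'I_n.+1 -> spx n -> spx n.+1;
  face_face : forall n (i j : 'I_n.+2) (x : spx n.+2), (i <= j)%N ->
    face i (face (lift ord0 j) x) = face j (face (widen_ord (leqnSn _) i) x);
  degen_degen : forall n (i j : 'I_n.+1) (x : spx n), (i <= j)%N ->
    degen (widen_ord (leqnSn _) i) (degen j x) =
    degen (lift ord0 j) (degen i x);
  face_degen_lt : forall n (i : 'I_n.+2) (j : 'I_n.+1) (x : spx n.+1), (i <= j)%N ->
    face (widen_ord (leqnSn _) i) (degen (lift ord0 j) x) = degen j (face i x);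
  face_degen_eq : forall n (j : 'I_n.+1) (x : spx n),
    face (widen_ord (leqnSn _) j) (degen j x) = x;
  face_degen_eqS : forall n (j : 'I_n.+1) (x : spx n),
    face (lift ord0 j) (degen j x) = x;
  face_degen_gt : forall n (i : 'I_n.+2) (j : 'I_n.+1) (x : spx n.+1), (j < i)%N ->
    face (lift ord0 i) (degen (widen_ord (leqnSn _) j) x) = degen j (face i x) }.

(* The iterated degeneracy s_(n-1) ... s_0. *)
Fixpoint sdegen (X : sset) n (x : X 0%N) : X n :=
  if n is n'.+1 then degen ord_max (sdegen n' x) else x.

(* Composition is written in diagrammatic order: scomp f g is g o f. *)
Record scat := SCat {
  obj :> Type;
  hom : obj -> obj -> sset;
  scomp : forall (A B C : obj) n, hom A B n -> hom B C n -> hom A C n;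
  sid : forall A : obj, hom A A 0%N;
  face_scomp : forall (A B C : obj) n (j : 'I_n.+2)
      (f : hom A B n.+1) (g : hom B C n.+1),
    face j (scomp f g) = scomp (face j f) (face j g);
  degen_scomp : forall (A B C : obj) n (j : 'I_n.+1)
      (f : hom A B n) (g : hom B C n),
    degen j (scomp f g) = scomp (degen j f) (degen j g);
  scompA : forall (A B C D : obj) n
      (f : hom A B n) (g : hom B C n) (h : hom C D n),
    scomp f (scomp g h) = scomp (scomp f g) h;
  scomp1l : forall (A B : obj) n (f : hom A B n), scomp (sdegen n (sid A)) f = f;
  scomp1r : forall (A B : obj) n (f : hom A B n), scomp f (sdegen n (sid B)) = f }.

Record sfunctor (S T : scat) := SFunctor {
  fobj :> S -> T;
  fhom : forall (A B : S) n, hom A B n -> hom (fobj A) (fobj B) n;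
  fhom_face : forall (A B : S) n (j : 'I_n.+2) (f : hom A B n.+1),
    fhom (face j f) = face j (fhom f);
  fhom_degen : forall (A B : S) n (j : 'I_n.+1) (f : hom A B n),
    fhom (degen j f) = degen j (fhom f);
  fhom_comp : forall (A B C : S) n (f : hom A B n) (g : hom B C n),
    fhom (scomp f g) = scomp (fhom f) (fhom g);
  fhom_id : forall A : S, fhom (sid A) = sid (fobj A) }.

(* The disjoint union of the sets of n-simplices of all hom-objects; for
   n = 0, the set of all 1-morphisms. *)
Record simplex (S : scat) n :=
  Simplex { src : S; tgt : S; arr : hom src tgt n }.

HB.instance Definition _ (S : scat) n := gen_eqMixin (simplex S n).
HB.instance Definition _ (S : scat) n := gen_choiceMixin (simplex S n).

Section Simplex.
Variable S : scat.

Definition sxface n (j : 'I_n.+2) (x : simplex S n.+1) : simplex S n :=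
  Simplex (face j (arr x)).
Definition sxdegen n (f : simplex S 0) : simplex S n :=
  Simplex (sdegen n (arr f)).

(* The composite g o f, if g and f are composable. *)
Definition sxcomp n (g f : simplex S n) : option (simplex S n) :=
  match pselect (tgt f = src g) with
  | left e => Some (Simplex
      (scomp (eq_rect _ (fun B => hom (src f) B n) (arr f) _ e) (arr g)))
  | right _ => None
  end.

Variant sxcomp_spec n : simplex S n -> simplex S n -> option (simplex S n) ->
    Prop :=
| SxcompSome A B C (f : hom A B n) (g : hom B C n) :
    sxcomp_spec (Simplex g) (Simplex f) (Some (Simplex (scomp f g)))
| SxcompNone f g of tgt f <> src g : sxcomp_spec g f None.

Lemma sxcompP n (g f : simplex S n) : sxcomp_spec g f (sxcomp g f).
Proof.
rewrite /sxcomp; case: pselect => [|ne]; last exact: SxcompNone.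
case: g f => [B' C g] [A B f] /= e; case: _ / e g => g.
exact: SxcompSome.
Qed.

Lemma sxcompE n A B C (f : hom A B n) (g : hom B C n) :
  sxcomp (Simplex g) (Simplex f) = Some (Simplex (scomp f g)).
Proof.
rewrite /sxcomp; case: pselect => [e|] //=.
by rewrite (Prop_irrelevance e erefl).
Qed.

Lemma sxcompN n (g f : simplex S n) : tgt f <> src g -> sxcomp g f = None.
Proof. by rewrite /sxcomp; case: pselect. Qed.

Lemma sxcompA n (h g f : simplex S n) :
  obind (sxcomp h) (sxcomp g f) = obind (fun k => sxcomp k f) (sxcomp h g).
Proof.
case: h g f => [C' D h] [B' C g] [A B f].
have [eC|nC] := pselect (C = C'); last first.
  rewrite [sxcomp (Simplex h) _]sxcompN //=.
  by have [e|nB] := pselect (B = B'); [subst B'; rewrite sxcompE|];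
    rewrite /= sxcompN.
subst C'; rewrite [sxcomp (Simplex h) _]sxcompE /=.
have [eB|nB] := pselect (B = B'); last by rewrite !sxcompN.
by subst B'; rewrite !sxcompE /= sxcompE scompA.
Qed.

Lemma sxface_sxcomp n (j : 'I_n.+2) (g f : simplex S n.+1) :
  sxcomp (sxface j g) (sxface j f) = omap (sxface j) (sxcomp g f).
Proof.
case: g f _ / (sxcompP g f) => [A B C f g|f g ne] /=; last by rewrite sxcompN.
by rewrite /sxface /= sxcompE face_scomp.
Qed.

Lemma sdegen_scomp n (A B C : S) (f : hom A B 0%N) (g : hom B C 0%N) :
  sdegen n (scomp f g) = scomp (sdegen n f) (sdegen n g).
Proof. by elim: n => //= n ->; rewrite degen_scomp. Qed.

Lemma sxdegen_sxcomp n (g f : simplex S 0) :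
  sxcomp (sxdegen n g) (sxdegen n f) = omap (sxdegen n) (sxcomp g f).
Proof.
case: g f _ / (sxcompP g f) => [A B C f g|f g ne] /=; last by rewrite sxcompN.
by rewrite /sxdegen /= sxcompE sdegen_scomp.
Qed.

Lemma face_sdegen (X : sset) n (j : 'I_n.+2) (x : X 0%N) :
  face j (sdegen n.+1 x) = sdegen n x.
Proof.
elim: n j => [|n IHn] j.
  rewrite /=; case: (unliftP ord0 j) => [i|] ->.
    by rewrite [i]ord1 -(ord1 ord_max) face_degen_eqS.
  rewrite -[RHS](face_degen_eq ord_max); congr face; exact/val_inj.
rewrite [LHS]/=; have [lt_jn|ge_jn] := ltnP j n.+1; last first.
  have [e|ne] := eqVneq (j : nat) n.+1.
    have -> : j = widen_ord (leqnSn _) (ord_max : 'I_n.+2) by apply: val_inj.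
    by rewrite face_degen_eq.
  have -> : j = lift ord0 (ord_max : 'I_n.+2).
    apply: val_inj => /=; rewrite /bump /= add1n; apply/eqP.
    by rewrite eqn_leq -ltnS ltn_ord /= ltn_neqAle eq_sym ne.
  by rewrite face_degen_eqS.
have -> : j = widen_ord (leqnSn _) (Ordinal (ltnW lt_jn : (j < n.+2)%N)).
  exact: val_inj.
have -> : ord_max = lift ord0 (ord_max : 'I_n.+1) :> 'I_n.+2.
  by apply: val_inj; rewrite /= /bump.
by rewrite face_degen_lt ?IHn //= -ltnS.
Qed.

Lemma sxface_sxdegen n (j : 'I_n.+2) (f : simplex S 0) :
  sxface j (sxdegen n.+1 f) = sxdegen n f.
Proof. by rewrite /sxface /sxdegen [arr _]/= face_sdegen. Qed.
End Simplex.

Section FunctorSimplex.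
Variables (S T : scat) (f : sfunctor S T).

Definition sxmap n (x : simplex S n) : simplex T n := Simplex (fhom f (arr x)).

Lemma sxmap_face n (j : 'I_n.+2) (x : simplex S n.+1) :
  sxmap (sxface j x) = sxface j (sxmap x).
Proof. by rewrite /sxmap /sxface fhom_face. Qed.

Lemma sxmap_degen n (x : simplex S 0) : sxmap (sxdegen n x) = sxdegen n (sxmap x).
Proof.
rewrite /sxmap /sxdegen /=; congr Simplex.
by elim: n => //= n <-; rewrite fhom_degen.
Qed.
End FunctorSimplex.

Definition pathalg (R : pzRingType) (S : scat) : lmodType R :=
  freemod R^o (simplex S 0).

(* On 1-morphisms, pathmul g f is g o f, or 0 if they are not composable. *)
Definition pathmul (R : pzRingType) (S : scat) (a b : pathalg R S) :
    pathalg R S :=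
  mbil *%R (@sxcomp S 0) a b.

Definition pathmap (R : pzRingType) (S T : scat) (f : sfunctor S T) :
    pathalg R S -> pathalg R T :=
  push (@sxmap S T f 0).

Lemma mulr_zmor_l (R : pzRingType) (b : R) : GRing.zmod_morphism (fun a => a * b).
Proof. by move=> a c; rewrite mulrBl. Qed.
Lemma mulr_zmor_r (R : pzRingType) (a : R) : GRing.zmod_morphism ( *%R a).
Proof. by move=> b c; rewrite mulrBr. Qed.

Lemma pathmulA (R : pzRingType) (S : scat) (a b c : pathalg R S) :
  pathmul a (pathmul b c) = pathmul (pathmul a b) c.
Proof.
apply/esym/mbil_assoc; try exact: mulr_zmor_l; try exact: mulr_zmor_r.
- by move=> *; rewrite mulrA.
- by move=> *; rewrite sxcompA.
Qed.

Section Chain.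
Variables (R R' : comPzRingType) (S : scat).

(* The simplex x, as a basis element, is << tensor 1 1 *g x >>. *)
Definition chain n : bimodType R R' :=
  freemod (tens R R') (simplex S n).

(* diff n is d_n; d_0 is the zero map, its codomain being irrelevant. *)
Definition diff n : chain n -> chain n.-1 :=
  if n is n'.+1 return chain n -> chain n.-1 then
    fun c => \sum_(j < n'.+2) (-1) ^+ j *:
      (push (@sxface S n' j) c : chain n')
  else fun=> 0.

(* The actions a.c of R[S] and c.b of R'[S]; a 1-morphism is composed with
   n-simplices through its iterated degeneracy. *)
Definition lpath n (a : pathalg R S) (c : chain n) : chain n :=
  mbil (fun (r : R) (t : tens R R') => r *: t)
       (fun f x => sxcomp (sxdegen n f) x) a c.
Definition rpath n (c : chain n) (b : pathalg R' S) : chain n :=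
  mbil (fun (t : tens R R') (r : R') => t *> r)
       (fun x g => sxcomp x (sxdegen n g)) c b.
End Chain.

Lemma push_id (U : zmodType) (K : choiceType) (x : {malg U[K]}) :
  push id x = x.
Proof.
by move: x; apply: malg_ext => [||k u]; rewrite ?pushU //; apply: push_zmor.
Qed.

Lemma push_push (U : zmodType) (K L M : choiceType) (h : L -> M) (g : K -> L)
  (x : {malg U[K]}) : push h (push g x) = push (fun k => h (g k)) x.
Proof.
move: x; apply: malg_ext => [||k u]; rewrite ?pushU //; last exact: push_zmor.
exact: zmor_comp (push_zmor h) (push_zmor g).
Qed.

Lemma push_scale (R : pzRingType) (V : lmodType R) (K L : choiceType)
    (h : K -> L) (a : R) (x : freemod V K) :
  push h (a *: x) = a *: (push h x : freemod V L).
Proof.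
move: x; apply: malg_ext => [||k u].
- exact: (zmor_comp (push_zmor h) (@scalerBr R (freemod V K) a)).
- exact: (zmor_comp (@scalerBr R (freemod V L) a) (push_zmor h)).
- by rewrite pushU !scaleU pushU.
Qed.

Lemma push_ract (R R' : pzRingType) (V : bimodType R R') (K L : choiceType)
    (h : K -> L) (b : R') (x : freemod V K) :
  push h (x *> b) = (push h x : freemod V L) *> b.
Proof.
move: x; apply: malg_ext => [||k u].
- exact: (zmor_comp (push_zmor h) (@ract_zmor _ _ (freemod V K) b)).
- exact: zmor_comp (@ract_zmor _ _ (freemod V L) b) (push_zmor h).
- by rewrite pushU !ractU pushU.
Qed.

Lemma zmor_sign (R : pzRingType) (U V : lmodType R) (h : U -> V) j u :
  GRing.zmod_morphism h -> h ((-1) ^+ j *: u) = (-1) ^+ j *: h u.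
Proof.
move=> hB; rewrite -signr_odd; case: (odd j); last by rewrite !scale1r.
by rewrite !scaleN1r zmorN.
Qed.

Section Diff.
Variables R R' : comPzRingType.
Local Notation chain := (chain R R').

Lemma diff_zmor (S : scat) n : GRing.zmod_morphism (@diff R R' S n).
Proof.
case: n => [|n] u v /=; first by rewrite subrr.
by rewrite -sumrB; apply: eq_bigr => j _; rewrite push_zmor scalerBr.
Qed.

Lemma diff_natural (S T : scat) (g : forall n, chain S n -> chain T n) :
    (forall n, GRing.zmod_morphism (@g n)) ->
    (forall n (j : 'I_n.+2) c,
       push (@sxface T n j) (g n.+1 c) = g n (push (@sxface S n j) c)) ->
  forall n c, diff (g n c) = g n.-1 (diff c).
Proof.
move=> gB gP [|n] c; first by rewrite /= (zmor0 (gB 0%N)).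
rewrite /= (zmor_sum (gB n)); apply: eq_bigr => j _.
by rewrite gP (zmor_sign _ _ (gB n)).
Qed.

Lemma diff_diff (S : scat) n (c : chain S n.+1) : diff (diff c) = 0.
Proof.
case: n c => [|n] //= c.
pose F (i : 'I_n.+2) (j : 'I_n.+3) : chain S n :=
  push (@sxface S n i) (push (@sxface S n.+1 j) c).
transitivity (\sum_(i < n.+2) \sum_(j < n.+3) (-1) ^+ (i + j) *: F i j).
  apply: eq_bigr => i _; rewrite (zmor_sum (push_zmor _)) scaler_sumr.
  by apply: eq_bigr => j _; rewrite push_scale scalerA exprD.
under eq_bigr => i _.
  rewrite (bigID (fun j : 'I_n.+3 => (i < j)%N)) /=; over.
rewrite big_split /=.
have -> : \sum_(i < n.+2) \sum_(j < n.+3 | (i < j)%N) (-1) ^+ (i + j) *: F i j =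
  - \sum_(i < n.+2) \sum_(j < n.+2 | (i <= j)%N)
      (-1) ^+ (i + j) *: F j (widen_ord (leqnSn _) i).
  rewrite -sumrN; apply: eq_bigr => i _.
  rewrite big_mkcond big_ord_recl /= add0r -sumrN [RHS]big_mkcond /=.
  apply: eq_bigr => j _; rewrite /bump /= add1n ltnS; case: ifP => // le_ij.
  rewrite addnS exprS mulN1r scaleNr; congr (- (_ *: _)).
  rewrite /F !push_push; congr (push _ c); apply: funext => x.
  by rewrite /sxface /= face_face.
rewrite (exchange_big_dep predT) //= addrC; apply/eqP; rewrite subr_eq0.
apply/eqP/eq_bigr => i _.
rewrite big_mkcond big_ord_recr /= ltn_ord addr0 [RHS]big_mkcond /=.
by apply: eq_bigr => j _; rewrite -leqNgt addnC.
Qed.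
End Diff.

Section PathAction.
Variables (R R' : comPzRingType) (S : scat).
Local Notation chain := (chain R R' S).

Let tscale_l (t : tens R R') : GRing.zmod_morphism (fun r : R => r *: t).
Proof. by move=> a b; rewrite scalerBl. Qed.
Let tscale_r (a : R) : GRing.zmod_morphism (fun t : tens R R' => a *: t).
Proof. exact: scalerBr. Qed.

Lemma lpath_zmor n (a : pathalg R S) :
  GRing.zmod_morphism (fun c : chain n => lpath a c).
Proof. exact/mbil_zmor_r/tscale_r. Qed.

Lemma rpath_zmor n (b : pathalg R' S) :
  GRing.zmod_morphism (fun c : chain n => rpath c b).
Proof. exact/(mbil_zmor_l _ (@ract_zmor _ _ _)). Qed.

Lemma lpathM n a b (c : chain n) : lpath (pathmul a b) c = lpath a (lpath b c).
Proof.
apply: mbil_assoc; try exact: tscale_l; try exact: tscale_r;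
  try exact: mulr_zmor_l; try exact: mulr_zmor_r.
- by move=> *; rewrite scalerA.
- by move=> g f x; rewrite sxcompA sxdegen_sxcomp; case: (sxcomp g f).
Qed.

Lemma rpathM n (c : chain n) a b : rpath c (pathmul a b) = rpath (rpath c a) b.
Proof.
apply/esym/mbil_assoc; try exact: (@ract_zmor _ _ (tens R R'));
  try exact: (@ract_zmor_r _ _ (tens R R'));
  try exact: mulr_zmor_l; try exact: mulr_zmor_r.
- by move=> *; rewrite ractA.
- by move=> x g f; rewrite -sxcompA sxdegen_sxcomp; case: (sxcomp g f).
Qed.

Lemma lpath_rpath n a (c : chain n) b : rpath (lpath a c) b = lpath a (rpath c b).
Proof.
apply: mbil_assoc; try exact: tscale_l; try exact: tscale_r;
  try exact: (@ract_zmor _ _ (tens R R'));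
  try exact: (@ract_zmor_r _ _ (tens R R')).
- by move=> *; rewrite scaler_ract.
- by move=> x g f; rewrite -sxcompA.
Qed.

Lemma diff_lpath n a (c : chain n) : diff (lpath a c) = lpath a (diff c).
Proof.
move: n c; apply: diff_natural => [n|n j c]; first exact: lpath_zmor.
rewrite -[a in RHS]push_id.
apply: push_mbil; [exact: tscale_l|exact: tscale_r|move=> g x].
by rewrite -sxface_sxcomp sxface_sxdegen.
Qed.

Lemma diff_rpath n b (c : chain n) : diff (rpath c b) = rpath (diff c) b.
Proof.
move: n c; apply: (@diff_natural _ _ _ _ (fun n c => rpath c b)) => [n|n j c].
  exact: rpath_zmor.
rewrite -[b in RHS]push_id.
apply: push_mbil; [exact: ract_zmor|exact: ract_zmor_r|move=> x g].
by rewrite -sxface_sxcomp sxface_sxdegen.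
Qed.

Lemma diff_scale n (a : R) (c : chain n) : diff (a *: c) = a *: diff c.
Proof.
move: n c; apply: (@diff_natural _ _ _ _ (fun n c => a *: c)) => [n|n j c].
  exact: scalerBr.
exact: push_scale.
Qed.

Lemma diff_ract n (b : R') (c : chain n) : diff (c *> b) = diff c *> b.
Proof.
move: n c; apply: (@diff_natural _ _ _ _ (fun n c => c *> b)) => [n|n j c].
  exact: ract_zmor.
exact: push_ract.
Qed.
End PathAction.

Section Homology.
Variables (R R' : comPzRingType) (S : scat) (n : nat).

Definition cycles : {pred chain R R' S n} := fun c => diff c == 0.

Fact cycles_closed : GRing.submod_closed cycles.
Proof.
split=> [|a u v /eqP du /eqP dv]; apply/eqP; first exact: zmor0 (@diff_zmor _ _ _ _).
by rewrite (zmorD (@diff_zmor _ _ _ _)) diff_scale du dv scaler0 addr0.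
Qed.

HB.instance Definition _ := GRing.isSubmodClosed.Build R _ cycles cycles_closed.

Record zcycle := ZCycle { zval : chain R R' S n; _ : zval \in cycles }.

HB.instance Definition _ := [isSub for zval].
HB.instance Definition _ := [Choice of zcycle by <:].
HB.instance Definition _ := [SubChoice_isSubLmodule of zcycle by <:].

Lemma zvalB : GRing.zmod_morphism zval.
Proof. exact: (raddfB (\val : zcycle -> chain R R' S n)). Qed.

Definition boundaries : {pred zcycle} :=
  fun z => `[< exists c : chain R R' S n.+1, diff c = zval z >].

Lemma boundariesP z :
  reflect (exists c : chain R R' S n.+1, diff c = zval z) (z \in boundaries).
Proof. exact: asboolP. Qed.

Fact boundaries_closed : GRing.zmod_closed boundaries.
Proof.
split=> [|u v /asboolP[c dc] /asboolP[c' dc']]; apply/asboolP.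
  by exists 0; rewrite (zmor0 (@diff_zmor _ _ _ _)) (zmor0 zvalB).
by exists (c - c'); rewrite diff_zmor zvalB dc dc'.
Qed.

HB.instance Definition _ :=
  GRing.isZmodClosed.Build _ boundaries boundaries_closed.

Definition homology : Type := Quotient.quot boundaries.

HB.instance Definition _ := GRing.Zmodule.copy homology (Quotient.quot boundaries).

Definition hclass (z : zcycle) : homology := \pi_(Quotient.quot boundaries) z.
End Homology.

Arguments cycles {R R' S n}.
Arguments boundaries {R R' S n}.

Section HomologyMap.
Variables (R R' : comPzRingType) (S T : scat).

Variable g : forall n, chain R R' S n -> chain R R' T n.
Hypothesis gB : forall n, GRing.zmod_morphism (@g n).
Hypothesis gd : forall n c, diff (g c) = g (diff c) :> chain R R' T n.-1.

Fact zmap_subproof n (z : zcycle R R' S n) : g (zval z) \in cycles.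
Proof.
case: z => c /= dc; apply/eqP; rewrite gd (eqP dc); exact: zmor0 (@gB _).
Qed.

Definition zmap n (z : zcycle R R' S n) : zcycle R R' T n :=
  ZCycle (zmap_subproof z).

Definition hmap n : homology R R' S n -> homology R R' T n :=
  quot_map boundaries boundaries (@zmap n).

Lemma zmap_zmor n : GRing.zmod_morphism (@zmap n).
Proof.
move=> u v; apply/val_inj; apply: etrans (esym (zvalB (zmap u) (zmap v))).
by rewrite -gB -zvalB.
Qed.

Lemma zmap_boundaries n z : z \in boundaries -> @zmap n z \in boundaries.
Proof.
by move=> zB; apply/boundariesP; case: (boundariesP _ zB) => c dc;
  exists (g c); rewrite gd dc.
Qed.

Lemma hmapE n (z : zcycle R R' S n) : hmap (hclass z) = hclass (zmap z).
Proof. exact: quot_mapE (@zmap_zmor n) (@zmap_boundaries n) z. Qed.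

Lemma hmap_zmor n : GRing.zmod_morphism (@hmap n).
Proof. exact: quot_map_zmor (@zmap_zmor n) (@zmap_boundaries n). Qed.
End HomologyMap.

Arguments zmap {R R' S T g} gB gd {n} z.
Arguments hmap {R R' S T g} gB gd {n} u.

Section HomologyMapTheory.
Variables (R R' : comPzRingType).

Lemma hclass_zmor (S : scat) n : GRing.zmod_morphism (@hclass R R' S n).
Proof. by move=> u v; rewrite /hclass raddfB. Qed.

Lemma hclassW (S : scat) n (P : homology R R' S n -> Prop) :
  (forall z, P (hclass z)) -> forall u, P u.
Proof. by move=> Pz; elim/quotW => z; apply: Pz. Qed.

Lemma eq_hclass (S : scat) n (z w : zcycle R R' S n) :
  zval z = zval w -> hclass z = hclass w.
Proof. by move=> e; congr hclass; apply/val_inj. Qed.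

Section Comp.
Variables S T1 T2 U : scat.
Variables (g1 : forall n, chain R R' S n -> chain R R' T1 n)
  (h1 : forall n, chain R R' T1 n -> chain R R' U n)
  (g2 : forall n, chain R R' S n -> chain R R' T2 n)
  (h2 : forall n, chain R R' T2 n -> chain R R' U n).
Variables (g1B : forall n, GRing.zmod_morphism (@g1 n))
  (g1d : forall n c, diff (g1 c) = g1 (diff c) :> chain R R' T1 n.-1)
  (h1B : forall n, GRing.zmod_morphism (@h1 n))
  (h1d : forall n c, diff (h1 c) = h1 (diff c) :> chain R R' U n.-1)
  (g2B : forall n, GRing.zmod_morphism (@g2 n))
  (g2d : forall n c, diff (g2 c) = g2 (diff c) :> chain R R' T2 n.-1)
  (h2B : forall n, GRing.zmod_morphism (@h2 n))
  (h2d : forall n c, diff (h2 c) = h2 (diff c) :> chain R R' U n.-1).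

Lemma hmap_comm n : (forall c : chain R R' S n, h1 (g1 c) = h2 (g2 c)) ->
  forall u : homology R R' S n, hmap h1B h1d (hmap g1B g1d u) = hmap h2B h2d (hmap g2B g2d u).
Proof.
move=> e; apply: hclassW => z.
rewrite (hmapE g1B) (hmapE g2B) (hmapE h1B) (hmapE h2B).
exact/eq_hclass/e.
Qed.
End Comp.

Section Act.
Variables S T : scat.
Variables g1 g2 g3 : forall n, chain R R' S n -> chain R R' T n.
Variables (g1B : forall n, GRing.zmod_morphism (@g1 n))
  (g1d : forall n c, diff (g1 c) = g1 (diff c) :> chain R R' T n.-1)
  (g2B : forall n, GRing.zmod_morphism (@g2 n))
  (g2d : forall n c, diff (g2 c) = g2 (diff c) :> chain R R' T n.-1)
  (g3B : forall n, GRing.zmod_morphism (@g3 n))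
  (g3d : forall n c, diff (g3 c) = g3 (diff c) :> chain R R' T n.-1).

Lemma hmap_add n : (forall c : chain R R' S n, g3 c = g1 c + g2 c) ->
  forall u : homology R R' S n, hmap g3B g3d u = hmap g1B g1d u + hmap g2B g2d u.
Proof.
move=> e; apply: hclassW => z.
rewrite (hmapE g3B) (hmapE g1B) (hmapE g2B) -(zmorD (@hclass_zmor T n)).
apply: eq_hclass; apply: etrans (esym (zmorD (@zvalB R R' T n) _ _)).
exact: e.
Qed.
End Act.

Section Id.
Variable S : scat.
Variables g1 g2 g3 : forall n, chain R R' S n -> chain R R' S n.
Variables (g1B : forall n, GRing.zmod_morphism (@g1 n))
  (g1d : forall n c, diff (g1 c) = g1 (diff c) :> chain R R' S n.-1)
  (g2B : forall n, GRing.zmod_morphism (@g2 n))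
  (g2d : forall n c, diff (g2 c) = g2 (diff c) :> chain R R' S n.-1)
  (g3B : forall n, GRing.zmod_morphism (@g3 n))
  (g3d : forall n c, diff (g3 c) = g3 (diff c) :> chain R R' S n.-1).

Lemma hmap_id n : (forall c : chain R R' S n, g1 c = c) ->
  forall u : homology R R' S n, hmap g1B g1d u = u.
Proof.
by move=> e; apply: hclassW => z; rewrite (hmapE g1B); apply/eq_hclass/e.
Qed.

Lemma hmap_comp n : (forall c : chain R R' S n, g1 (g2 c) = g3 c) ->
  forall u : homology R R' S n, hmap g1B g1d (hmap g2B g2d u) = hmap g3B g3d u.
Proof.
move=> e; apply: hclassW => z.
by rewrite (hmapE g3B) (hmapE g2B) (hmapE g1B); apply/eq_hclass/e.
Qed.
End Id.
End HomologyMapTheory.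

Section HomologyBimod.
Variables (R R' : comPzRingType) (S : scat).

Definition hscale n (a : R) : homology R R' S n -> homology R R' S n :=
  hmap (g := fun n c => a *: c) (fun n => @scalerBr _ _ a)
       (fun n c => diff_scale a c).

Definition hract n (u : homology R R' S n) (b : R') : homology R R' S n :=
  hmap (g := fun n c => c *> b) (fun n => @ract_zmor _ _ _ b)
       (fun n c => diff_ract b c) u.

(* The actions a.u of R[S] and u.b of R'[S]. *)
Definition hlpath n (a : pathalg R S) (u : homology R R' S n) :
    homology R R' S n :=
  hmap (g := fun n c => lpath a c) (fun n => @lpath_zmor _ _ _ n a)
       (fun n c => diff_lpath a c) u.

Definition hrpath n (u : homology R R' S n) (b : pathalg R' S) :
    homology R R' S n :=
  hmap (g := fun n c => rpath c b) (fun n => @rpath_zmor _ _ _ n b)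
       (fun n c => diff_rpath b c) u.

Variable n : nat.
Implicit Types u v : homology R R' S n.

Let hscaleA a b u : hscale a (hscale b u) = hscale (a * b) u.
Proof. by apply: hmap_comp => c; apply: scalerA. Qed.

Let hscale1 u : hscale 1 u = u.
Proof. by apply: hmap_id => c; apply: scale1r. Qed.

Let hscaleDr a u v : hscale a (u + v) = hscale a u + hscale a v.
Proof. exact/zmorD/hmap_zmor. Qed.

Let hscaleDl u a b : hscale (a + b) u = hscale a u + hscale b u.
Proof. by apply: hmap_add => c; apply: scalerDl. Qed.

HB.instance Definition _ := GRing.Zmodule_isLmodule.Build R (homology R R' S n)
  hscaleA hscale1 hscaleDr hscaleDl.

Let hractDl u v b : hract (u + v) b = hract u b + hract v b.
Proof.
apply: (@zmorD _ _ (fun u => hract u b)); exact: hmap_zmor.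
Qed.

Let hractDr u b c : hract u (b + c) = hract u b + hract u c.
Proof. by apply: hmap_add => x; apply: ractDr. Qed.

Let hractr1 u : hract u 1 = u.
Proof. by apply: hmap_id => c; apply: ractr1. Qed.

Let hractA u b c : hract (hract u b) c = hract u (b * c).
Proof. by apply: hmap_comp => x; apply: ractA. Qed.

Let hscale_ract (a : R) u b : a *: hract u b = hract (a *: u) b.
Proof. by apply: hmap_comm => x; apply: scaler_ract. Qed.

HB.instance Definition _ := Lmodule_isBimodule.Build R R' (homology R R' S n)
  hractDl hractDr hractr1 hractA hscale_ract.
End HomologyBimod.

Section Functoriality.
Variables (R R' : comPzRingType) (S T : scat) (f : sfunctor S T).

(* f_* *)
Definition chainmap n : chain R R' S n -> chain R R' T n :=
  push (@sxmap S T f n).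

Lemma chainmap_zmor n : GRing.zmod_morphism (@chainmap n).
Proof. exact: push_zmor. Qed.

Lemma diff_chainmap n (c : chain R R' S n) :
  diff (chainmap c) = chainmap (diff c).
Proof.
move: n c; apply: diff_natural => [n|n j c]; first exact: chainmap_zmor.
rewrite /chainmap !push_push; congr (push _ c); apply: funext => x.
by rewrite sxmap_face.
Qed.

Definition cyclemap n : zcycle R R' S n -> zcycle R R' T n :=
  zmap chainmap_zmor diff_chainmap.

Definition homologymap n : homology R R' S n -> homology R R' T n :=
  hmap chainmap_zmor diff_chainmap.
End Functoriality.

(* Main.v *)
Require Import Defs.
From HB Require Import structures.
From mathcomp Require Import all_boot all_order all_algebra.

Import GRing.Theory.

(** The map [f_*] relabels basis simplices and keeps coefficients, so it commutes with faces and
    with both scalar actions; this gives the bimodule map on homology. For the path algebra actions,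
    [hmap_comm] reduces an identity in homology to one on chains, and [push_mbil] reduces that to
    basis simplices. There a functor preserves defined composites, and [sxmap_sxcomp] treats the
    undefined ones. *)

(* Injectivity on objects is what makes undefined composites in S stay
   undefined in T. *)
Lemma sxmap_sxcomp (S T : scat) (f : sfunctor S T) n (h g : simplex S n) :
  injective (fobj f) ->
  sxcomp (sxmap f h) (sxmap f g) = omap (@sxmap S T f n) (sxcomp h g).
Proof.
move=> f_inj; case: h g _ / (sxcompP h g) => [A B C g h|g h ne] /=.
  by rewrite /sxmap /= sxcompE fhom_comp.
by rewrite sxcompN //= => /f_inj.
Qed.

Section ChainMap.
Variables (R R' : comPzRingType) (S T : scat) (f : sfunctor S T) (n : nat).
Implicit Type c : chain R R' S n.

Lemma chainmap_lpath (a : pathalg R S) c : injective (fobj f) ->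
  chainmap f (lpath a c) = lpath (pathmap f a) (chainmap f c).
Proof.
move=> f_inj; apply: push_mbil => [t u v|r u v|g x].
- by rewrite scalerBl.
- by rewrite scalerBr.
(* A [1]-morphism acts through its iterated degeneracy, which [f] preserves, so only composition of
   [n]-simplices remains to be compared. *)
- by rewrite -sxmap_degen sxmap_sxcomp.
Qed.

Lemma chainmap_rpath c (b : pathalg R' S) : injective (fobj f) ->
  chainmap f (rpath c b) = rpath (chainmap f c) (pathmap f b).
Proof.
move=> f_inj; apply: push_mbil => [r|t|x g].
- exact: (@ract_zmor _ _ (tens R R')).
- exact: (@ract_zmor_r _ _ (tens R R')).
- by rewrite -sxmap_degen sxmap_sxcomp.
Qed.

Implicit Type u : homology R R' S n.

Lemma homologymap_hlpath (a : pathalg R S) u : injective (fobj f) ->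
  homologymap f (hlpath a u) = hlpath (pathmap f a) (homologymap f u).
Proof. by move=> f_inj; apply: hmap_comm => c; apply: chainmap_lpath. Qed.

Lemma homologymap_hrpath u (b : pathalg R' S) : injective (fobj f) ->
  homologymap f (hrpath u b) = hrpath (homologymap f u) (pathmap f b).
Proof. by move=> f_inj; apply: hmap_comm => c; apply: chainmap_rpath. Qed.

(** Scalars act on the coefficients in [tens R R'], while [f_*] moves only the basis, so the two
    commute already on chains. *)
Lemma homologymap_hom : bimod_hom (fun u => homologymap f u).
Proof.
split=> [|a|u b].
- exact/zmorD/hmap_zmor.
- by apply: hmap_comm => c; apply: push_scale.
- by move: u; apply: hmap_comm => c; apply: push_ract.
Qed.
End ChainMap.

Theorem corollary18 (R R' : comPzRingType) (S T : scat) (f : sfunctor S T) :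
  (forall n : nat,
     (forall z : zcycle R R' S n,
        homologymap f (hclass z) = hclass (cyclemap f z)) /\
     bimod_hom (fun u : homology R R' S n => homologymap f u)) /\
  (injective (fobj f) ->
   forall (n : nat) (a : pathalg R S) (b : pathalg R' S)
          (u : homology R R' S n),
     homologymap f (hrpath (hlpath a u) b) =
     hrpath (hlpath (pathmap f a) (homologymap f u)) (pathmap f b)).
Proof.
split=> [n|f_inj n a b u].
  (* [homologymap] is defined through a chosen representative; [hmapE] shows the choice is
     immaterial, since [f_*] preserves boundaries. *)
  by split=> [z|]; [apply: hmapE | apply: homologymap_hom].
by rewrite homologymap_hrpath // homologymap_hlpath.
Qed.
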